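(* Let $R$ be a unital associative ring and let $M$ be a non-zero right $R$-module. The following statements are equivalent: (a) For any isomorphic direct summands $D_1$ and $D_2$ of $M$, if $\mathrm{Hom}(D_1,M/D_1)=0$, then $\mathrm{Hom}(D_2,M/D_2)=0$. (a') For any isomorphic direct summands $D_1$ and $D_2$ of $M$, if $\mathrm{Hom}(M/D_1,D_1)=0$, then $\mathrm{Hom}(M/D_2,D_2)=0$. (b) For any isomorphic direct summands $D_1$ and $D_2$ of $M$, if $\mathrm{Hom}(D_1,M/D_1)=0$ or $\mathrm{Hom}(M/D_1,D_1)=0$, then $M/D_1\simeq M/D_2$. (c) The endomorphism ring $\mathrm{End}(M)$ is Dedekind-finite.
   Context: Rings are associative with unit, not necessarily commutative. $\mathrm{Hom}$, $\mathrm{End}$ and isomorphisms $\simeq$ are those of right $R$-modules. A ring $S$ is Dedekind-finite if for all $a,b\in S$, $ab=1$ implies $ba=1$. *)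

(* Defs.v *)
From HB Require Import structures.
From mathcomp Require Import all_boot all_algebra.
From mathcomp Require Import boolp.

Set Implicit Arguments.
Unset Strict Implicit.
Unset Printing Implicit Defensive.

Import GRing.Theory.
Local Open Scope ring_scope.
Local Open Scope quotient_scope.

(* A right R-module is a left module over the opposite ring R^c: the element  *)
(* written x r on paper is r *: x here, and r *: (s *: x) is the action of    *)
(* the product s r of R.                                                      *)
Notation rmodType R := (lmodType R^c).

(* Submodules are boolean predicates; by excluded middle this loses none.     *)
Definition submod (R : pzRingType) (M : lmodType R) (D : submodClosed M) :=
  {x : M | x \in D}.

Section Submod.
Variables (R : pzRingType) (M : lmodType R) (D : submodClosed M).
HB.instance Definition _ := SubChoice.on (submod D).
HB.instance Definition _ := [SubChoice_isSubLmodule of submod D by <:].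
End Submod.

(* A submodClosed predicate is not declared stable under opposite, which the  *)
(* additive quotient Quotient.quot requires.                                  *)
Fact submod_zmod_closed (R : pzRingType) (M : lmodType R)
  (D : submodClosed M) : zmod_closed D.
Proof. exact/GRing.submod_closedB/submodClosedP. Qed.

Definition submod_zmod (R : pzRingType) (M : lmodType R)
    (D : submodClosed M) : zmodClosed M :=
  HB.pack (GRing.SubmodClosed.sort D)
    (GRing.isZmodClosed.Build M _ (submod_zmod_closed D)).

Definition quotmod (R : pzRingType) (M : lmodType R) (D : submodClosed M) :=
  Quotient.quot (submod_zmod D).

Section QuotMod.
Variables (R : pzRingType) (M : lmodType R) (D : submodClosed M).
Local Notation Q := (quotmod D).

HB.instance Definition _ := GRing.Zmodule.on Q.
HB.instance Definition _ : EqQuotient M (Quotient.equiv (submod_zmod D)) Q :=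
  EqQuotient.on Q.
HB.instance Definition _ := ZmodQuotient.on Q.

Definition quotmod_scale (a : R) (u : Q) : Q := \pi_Q (a *: repr u).

Lemma quotmod_eq (x y : M) : (\pi_Q x == \pi_Q y) = (x - y \in D).
Proof. by rewrite -Quotient.idealrBE. Qed.

Lemma quotmod_scaleE a (x : M) : quotmod_scale a (\pi_Q x) = \pi_Q (a *: x).
Proof.
apply/eqP; rewrite quotmod_eq -scalerBr rpredZ //.
by rewrite -quotmod_eq reprK.
Qed.

Fact quotmod_scaleA a b u :
  quotmod_scale a (quotmod_scale b u) = quotmod_scale (a * b) u.
Proof.
by elim/quotW: u => x; rewrite (quotmod_scaleE b) !quotmod_scaleE scalerA.
Qed.

Fact quotmod_scale1 : left_id 1 quotmod_scale.
Proof. by elim/quotW => x; rewrite quotmod_scaleE scale1r. Qed.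

Fact quotmod_scaleDr : right_distributive quotmod_scale +%R.
Proof.
move=> a; elim/quotW => x; elim/quotW => y; rewrite -raddfD !quotmod_scaleE.
by rewrite scalerDr raddfD.
Qed.

Fact quotmod_scaleDl u : {morph quotmod_scale^~ u : a b / a + b}.
Proof. by elim/quotW: u => x a b; rewrite !quotmod_scaleE scalerDl raddfD. Qed.

HB.instance Definition _ := GRing.Zmodule_isLmodule.Build R Q
  quotmod_scaleA quotmod_scale1 quotmod_scaleDr quotmod_scaleDl.

Fact quotmod_pi_scalable : scalable \pi_Q.
Proof. by move=> a x; rewrite -quotmod_scaleE. Qed.

HB.instance Definition _ := GRing.isScalable.Build R M Q *:%R \pi_Q
  quotmod_pi_scalable.
End QuotMod.

Definition endo (R : pzRingType) (M : lmodType R) := {linear M -> M}.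

Section EndoRing.
Variables (R : pzRingType) (M : lmodType R).
Local Notation E := (endo M).

HB.instance Definition _ := gen_eqMixin E.
HB.instance Definition _ := gen_choiceMixin E.

Lemma endoP (f g : E) : (f : M -> M) =1 g <-> f = g.
Proof.
split=> [|-> //]; case: f g => [f [[fa] [fs]]] [g [[ga] [gs]]] /funext/= fg.
case: _ / fg in ga gs *.
by rewrite (Prop_irrelevance fa ga) (Prop_irrelevance fs gs).
Qed.

Definition endo_add (f g : E) : E := f \+ g.
Definition endo_opp (f : E) : E := \- f.
Definition endo_mul (f g : E) : E := f \o g.

Fact endo_addA : associative endo_add.
Proof. by move=> f g h; apply/endoP => x /=; rewrite addrA. Qed.

Fact endo_addC : commutative endo_add.
Proof. by move=> f g; apply/endoP => x /=; rewrite addrC. Qed.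

Fact endo_add0 : left_id (\0 : E) endo_add.
Proof. by move=> f; apply/endoP => x /=; rewrite add0r. Qed.

Fact endo_addN : left_inverse (\0 : E) endo_opp endo_add.
Proof. by move=> f; apply/endoP => x /=; rewrite addNr. Qed.

HB.instance Definition _ :=
  GRing.isZmodule.Build E endo_addA endo_addC endo_add0 endo_addN.

Fact endo_mulA : associative endo_mul.
Proof. by move=> f g h; apply/endoP. Qed.

Fact endo_mul1 : left_id (idfun : E) endo_mul.
Proof. by move=> f; apply/endoP. Qed.

Fact endo_mulr1 : right_id (idfun : E) endo_mul.
Proof. by move=> f; apply/endoP. Qed.

Fact endo_mulDl : left_distributive endo_mul +%R.
Proof. by move=> f g h; apply/endoP. Qed.

Fact endo_mulDr : right_distributive endo_mul +%R.
Proof. by move=> f g h; apply/endoP => x /=; rewrite raddfD. Qed.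

HB.instance Definition _ := GRing.Zmodule_isPzRing.Build E
  endo_mulA endo_mul1 endo_mulr1 endo_mulDl endo_mulDr.

Lemma endoME (f g : E) x : (f * g) x = f (g x).
Proof. by []. Qed.

Lemma endo1E x : (1 : E) x = x.
Proof. by []. Qed.
End EndoRing.

Definition dedekind_finite (S : pzRingType) : Prop :=
  forall a b : S, a * b = 1 -> b * a = 1.

Definition hom_zero (R : pzRingType) (U V : lmodType R) : Prop :=
  forall f : {linear U -> V}, f =1 \0.

Definition isomorphic (R : pzRingType) (U V : lmodType R) : Prop :=
  exists f : {linear U -> V}, bijective f.

Definition direct_summand (R : pzRingType) (M : lmodType R)
    (D : submodClosed M) : Prop :=
  exists E : submodClosed M,
    (forall x, exists2 y, y \in D & exists2 z, z \in E & x = y + z) /\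
    (forall x, x \in D -> x \in E -> x = 0).

(* Main.v *)
Require Import Defs.
From HB Require Import structures.
From mathcomp Require Import all_boot all_algebra.
From mathcomp Require Import boolp.

Set Implicit Arguments.
Unset Strict Implicit.
Unset Printing Implicit Defensive.

Import GRing.Theory.
Local Open Scope ring_scope.
Local Open Scope quotient_scope.

(** Direct summands of M are ranges of idempotents of S = End(M), and every
    condition of the theorem can be read off from such idempotents.  If e
    projects M onto D, then D splits e and M/D splits 1 - e, in the sense of
    [splits]; for modules N and P splitting e and f, [hom_zero_corner] says that
    Hom(N, P) = 0 iff f S e = 0, and [isomorphic_equiv] that N and P are
    isomorphic iff e = u v and f = v u for some u, v in S.

    Let S be Dedekind-finite, e = u v and f = v u, and suppose that
    Hom(D1, M/D1) = 0, that is (1 - e) S e = 0.  Then v e, which maps D1 onto D2,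
    lies in the corner ring e S e, hence D2 is contained in D1, and it has the
    left-inverse partner e u e there: (e u e) (v e) = e.  The corner inherits
    Dedekind-finiteness ([corner_dedekind_finite]), so (v e) (e u e) = e and
    D1 = D2 ([equiv_eq_range]).  The conclusions of (a) and (b) follow at once.
    If instead Hom(M/D1, D1) = 0, the same argument runs in the opposite ring;
    there it says that the two projections have equal kernels, which gives (a')
    and (b).

    Conversely let a b = 1 in S.  Then b a is an idempotent whose range D is
    isomorphic to M, the range of 1 ([left_inverse_summands]).  Since M/M = 0,
    both Hom conditions hold for D1 = M.  For D2 = D each conclusion forces
    1 - b a = 0: in (b) because M/D is then zero, in (a) and (a') because the
    complement of D both receives a nonzero map from D, which is a copy of M, and
    embeds in D, unless it is zero. *)

(** * Idempotents of a Dedekind-finite ring *)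

Section IdempotentRing.
Variable S : pzRingType.
Implicit Types a b e f g p q u v x y : S.

Definition corner_zero p q := forall g, p * g * q = 0.

(** Murray-von Neumann equivalence of idempotents. *)
Definition idem_equiv e f := exists u v, u * v = e /\ v * u = f.

(** Adding the complementary idempotent 1 - e turns a one-sided inverse in the
    corner e S e into a one-sided inverse in S. *)
Lemma corner_dedekind_finite e x y : dedekind_finite S ->
  e * x = x -> x * e = x -> e * y = y -> y * e = y -> x * y = e -> y * x = e.
Proof.
move=> df ex xe ey ye xy.
have ee : e * e = e by rewrite -{2}xy mulrA ex xy.
have mulD z t : z * e = z -> e * t = t ->
    (z + (1 - e)) * (t + (1 - e)) = z * t + (1 - e).
  move=> ze et.
  have z0 : z * (1 - e) = 0 by rewrite mulrBr mulr1 ze subrr.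
  have t0 : (1 - e) * t = 0 by rewrite mulrBl mul1r et subrr.
  have e0 : (1 - e) * (1 - e) = 1 - e.
    by rewrite mulrBl mul1r mulrBr mulr1 ee subrr subr0.
  by rewrite mulrDl (mulrDr z) (mulrDr (1 - e)) z0 t0 e0 addr0 add0r.
have := df (x + (1 - e)) (y + (1 - e)).
rewrite !mulD // xy addrC subrK => /(_ erefl) yx1.
by apply: (addIr (1 - e)); rewrite yx1 addrC subrK.
Qed.

(** The equations e f = f and f e = e say that e and f have the same range.
    When e S e contains S e, the element v e of S already lives in the corner
    e S e, so f = v e u is absorbed by e on the left.  Moreover
    (e u e) (v e) = e in e S e, and the reversed product (v e) (e u e) is f e. *)
Lemma equiv_eq_range e f : dedekind_finite S ->
  e * e = e -> f * f = f -> idem_equiv e f -> corner_zero (1 - e) e ->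
  e * f = f /\ f * e = e.
Proof.
move=> df ee ff [u [v [uv vu]]] e0.
have eve : e * (v * e) = v * e.
  by have /eqP := e0 v; rewrite !mulrBl mul1r subr_eq0 -mulrA => /eqP.
have veu : v * e * u = f by rewrite -uv !mulrA vu -mulrA vu ff.
have yx : v * e * (e * u * e) = e.
  apply: corner_dedekind_finite => //.
  - by rewrite !mulrA ee.
  - by rewrite -mulrA ee.
  - by rewrite -mulrA ee.
  - by rewrite -!mulrA eve (mulrA u) uv ee.
split; first by rewrite -veu mulrA eve.
by rewrite -[RHS]yx -veu !mulrA -(mulrA v e e) ee.
Qed.

Lemma oneB_idem e : e * e = e -> (1 - e) * (1 - e) = 1 - e.
Proof. by move=> ee; rewrite mulrBl mul1r mulrBr mulr1 ee subrr subr0. Qed.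

(** Since e and f have the same range, each of 1 - e and 1 - f absorbs the other
    on the right: (1 - e) (1 - f) = 1 - e and (1 - f) (1 - e) = 1 - f. *)
Lemma equiv_complement e f : dedekind_finite S ->
  e * e = e -> f * f = f -> idem_equiv e f -> corner_zero (1 - e) e ->
  corner_zero (1 - f) f /\ idem_equiv (1 - e) (1 - f).
Proof.
move=> df ee ff ef e0; have [eff fee] := equiv_eq_range df ee ff ef e0.
have efC : (1 - e) * (1 - f) = 1 - e.
  by rewrite mulrBr mulr1 mulrBl mul1r eff subrr subr0.
have feC : (1 - f) * (1 - e) = 1 - f.
  by rewrite mulrBr mulr1 mulrBl mul1r fee subrr subr0.
split; last by exists (1 - e), (1 - f).
move=> g; rewrite -feC -eff mulrA -(mulrA _ _ g) -(mulrA _ _ e) e0.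
by rewrite mulr0 mul0r.
Qed.

(** The element a of the corner condition is the isomorphism from the range of
    b a onto the whole module, followed there by the projection 1 - b a. *)
Lemma corner_left_inverse a b :
  a * b = 1 -> corner_zero (1 - b * a) (b * a) -> b * a = 1.
Proof.
move=> ab /(_ a); rewrite -mulrA (mulrA a) ab mul1r => /(congr1 ( *%R^~ b)).
by rewrite -mulrA ab mulr1 mul0r => /eqP; rewrite subr_eq0 => /eqP.
Qed.

Lemma equiv0_eq0 p : p * p = p -> idem_equiv 0 p -> p = 0.
Proof.
move=> pp [u [v [uv vu]]].
by rewrite -pp -vu mulrA -(mulrA v) uv mulr0 mul0r.
Qed.

Lemma left_inverse_idem a b : a * b = 1 -> b * a * (b * a) = b * a.
Proof. by move=> ab; rewrite mulrA -(mulrA b) ab mulr1. Qed.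
End IdempotentRing.

(** Dedekind-finiteness and equivalence of idempotents are left-right symmetric,
    so passing to S^c exchanges the conditions (1 - e) S e = 0 and
    e S (1 - e) = 0. *)
Section Opposite.
Variable S : pzRingType.
Implicit Types a b e f : S.

Lemma equiv_complement_op e f : dedekind_finite S ->
  e * e = e -> f * f = f -> idem_equiv e f -> corner_zero e (1 - e) ->
  corner_zero f (1 - f) /\ idem_equiv (1 - e) (1 - f).
Proof.
move=> df ee ff [u [v [uv vu]]] e0.
have [||||| f0 [u' [v' [uv' vu']]]] := @equiv_complement S^c e f => //.
- by move=> a b /df.
- by exists v, u.
- by move=> g; have := e0 g; rewrite -mulrA.
split; last by exists v', u'.
by move=> g; rewrite -mulrA; apply: f0.
Qed.

Lemma corner_left_inverse_op a b :
  a * b = 1 -> corner_zero (b * a) (1 - b * a) -> b * a = 1.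
Proof.
move=> ab f0; apply: (@corner_left_inverse S^c b a ab) => g.
by have := f0 g; rewrite -mulrA.
Qed.
End Opposite.

(** * Modules splitting an idempotent endomorphism *)

Section SplitIdempotents.
Variables (R : pzRingType) (M : lmodType R).

Lemma endo1BE (e : endo M) x : (1 - e) x = x - e x.
Proof. by []. Qed.

(** Submodules and quotient modules of M are handled alike through a retraction
    p : M -> N with section i; the idempotent i p determines N up to isomorphism. *)
Definition splits (N : lmodType R) (e : endo M) :=
  exists (i : {linear N -> M}) (p : {linear M -> N}),
    cancel i p /\ forall x, i (p x) = e x.

(** A map h : N -> P extends to the endomorphism j h p of M, and an endomorphism g
    restricts to the map q g i; up to e and f these are mutually inverse. *)
Lemma hom_zero_corner (N P : lmodType R) (e f : endo M) :
  splits N e -> splits P f -> hom_zero N P <-> corner_zero f e.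
Proof.
move=> [i [p [ip ipE]]] [j [q [jq jqE]]]; split=> [homNP g | f0 h x].
  apply/endoP => x; have /= := homNP (q \o g \o i) (p x).
  by rewrite -jqE -ipE => ->; rewrite raddf0.
have := congr1 (fun k : endo M => k (i x)) (f0 (j \o h \o p : {linear M -> M})).
by rewrite /= -jqE -ipE /= ip jq ip => /(congr1 q); rewrite jq raddf0.
Qed.

Lemma splits_idem (N : lmodType R) (e : endo M) : splits N e -> e * e = e.
Proof.
by move=> [i [p [ip ipE]]]; apply/endoP => x; rewrite endoME -!ipE ip.
Qed.

Lemma isomorphic_equiv (N P : lmodType R) (e f : endo M) :
  splits N e -> splits P f -> isomorphic N P <-> idem_equiv e f.
Proof.
move=> Ne Pf; have [ee ff] := (splits_idem Ne, splits_idem Pf).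
case: Ne Pf => [i [p [ip ipE]]] [j [q [jq jqE]]]; split=> [[h [k hk kh]]|].
  pose K : {linear P -> N} := HB.pack k
    (GRing.isLinear.Build _ _ _ _ k (can2_linear hk kh)).
  exists (i \o K \o q : {linear M -> M}), (j \o h \o p : {linear M -> M}).
  by split; apply/endoP => x; rewrite endoME /= ?jq ?ip ?hk ?kh.
case=> u [v [uv vu]]; exists (q \o v \o i); exists (p \o u \o j) => x /=.
- have: (u * f * v) (i x) = i x.
    by rewrite -vu mulrA -(mulrA (u * v)) uv ee -ipE ip.
  by rewrite !endoME -jqE => ->.
- have: (v * e * u) (j x) = j x.
    by rewrite -uv mulrA -(mulrA (v * u)) vu ff -jqE jq.
  by rewrite !endoME -ipE => ->.
Qed.

(** * Direct summands and projections *)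

Section Range.
Variable (e : endo M).
Definition range_pred : {pred M} := [pred x | e x == x].
Fact range_closed : submod_closed range_pred.
Proof.
split=> [|a x y]; rewrite !inE ?raddf0 // => /eqP ex /eqP ey.
by rewrite linearP ex ey.
Qed.
Definition range : submodClosed M :=
  HB.pack range_pred (GRing.isSubmodClosed.Build R M range_pred range_closed).
End Range.

Lemma mem_range (e : endo M) x : (x \in range e) = (e x == x).
Proof. by []. Qed.

Lemma range_summand (e : endo M) : e * e = e -> direct_summand (range e).
Proof.
move=> ee; have e1e := oneB_idem ee.
exists (range (1 - e)); split=> x.
  exists (e x); first by rewrite mem_range -endoME ee.
  exists ((1 - e) x); first by rewrite mem_range -endoME e1e.
  by rewrite endo1BE addrC subrK.
rewrite !mem_range => /eqP ex /eqP <-.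
by rewrite endo1BE ex subrr.
Qed.

(** The decomposition of each element into components is a mere existence
    statement, so the projection is obtained by choice; directness makes the
    component in D unique, whence linear in the element. *)
Lemma summand_projection (D : submodClosed M) : direct_summand D ->
  exists2 e : endo M, e * e = e & forall x, (x \in D) = (e x == x).
Proof.
case=> E [DE DE0].
have /choice[e eP] x : exists y, y \in D /\ x - y \in E.
  have [y Dy [z Ez ->]] := DE x; exists y; split=> //.
  by rewrite addrC addrA addNr add0r.
have eE x y : y \in D -> x - y \in E -> e x = y.
  move=> Dy Exy; have [Dex Eex] := eP x.
  apply/eqP; rewrite -subr_eq0; apply/eqP/DE0.
    exact: (submod_zmod_closed D).2.
  have -> : e x - y = (x - y) - (x - e x) by rewrite opprB [RHS]addrC addrA subrK.
  exact: (submod_zmod_closed E).2.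
have e_lin : linear e.
  move=> a x y; apply: eE; first by rewrite rpredD ?rpredZ ?(eP x).1 ?(eP y).1.
  by rewrite opprD addrACA -scalerBr rpredD ?rpredZ ?(eP x).2 ?(eP y).2.
pose e' : endo M := HB.pack e (GRing.isLinear.Build _ _ _ _ e e_lin).
have eD x : (x \in D) = (e x == x).
  apply/idP/eqP => [Dx|<-]; last exact: (eP x).1.
  by apply: eE; rewrite // subrr rpred0.
exists e' => //; apply/endoP => x; apply/eqP.
by rewrite endoME -[_ == _]eD; apply: (eP x).1.
Qed.

Lemma submod_splits (D : submodClosed M) (e : endo M) : e * e = e ->
  (forall x, (x \in D) = (e x == x)) -> splits (submod D) e.
Proof.
move=> ee eD.
have De x : e x \in D by rewrite eD -endoME ee.
pose p x : submod D := Sub (e x) (De x).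
have p_lin : linear p.
  by move=> a x y; apply: val_inj; rewrite linearP !SubK linearP.
pose p' : {linear M -> submod D} :=
  HB.pack p (GRing.isLinear.Build _ _ _ _ p p_lin).
exists (val : {linear submod D -> M}), p'; split=> // x.
by apply: val_inj; have := valP x; rewrite eD => /eqP.
Qed.

(** Because 1 - e kills D, it factors through the quotient by D, and the induced
    map is a section of the canonical projection. *)
Lemma quotmod_splits (D : submodClosed M) (e : endo M) : e * e = e ->
  (forall x, (x \in D) = (e x == x)) -> splits (quotmod D) (1 - e).
Proof.
move=> ee eD.
pose i (u : quotmod D) := (1 - e) (repr u).
have ipi x : i (\pi_(quotmod D) x) = (1 - e) x.
  apply/eqP; rewrite -subr_eq0 -linearB.
  have : repr (\pi_(quotmod D) x) - x \in D by rewrite -quotmod_eq reprK.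
  by rewrite eD => /eqP; set y := repr _ - x => ey; rewrite endo1BE ey subrr.
have i_lin : linear i.
  move=> a; elim/quotW => x; elim/quotW => y.
  by rewrite -linearP !ipi linearP.
pose i' : {linear quotmod D -> M} :=
  HB.pack i (GRing.isLinear.Build _ _ _ _ i i_lin).
exists i', (\pi_(quotmod D) : {linear M -> quotmod D}).
split=> [u|x] /=; last exact: ipi.
elim/quotW: u => x; rewrite ipi; apply/eqP; rewrite eq_sym quotmod_eq.
by rewrite endo1BE opprB addrC subrK eD -endoME ee.
Qed.

Lemma summand_splits (D : submodClosed M) : direct_summand D ->
  exists2 e : endo M, splits (submod D) e & splits (quotmod D) (1 - e).
Proof.
move=> /summand_projection[e ee eD].
by exists e; [apply: submod_splits | apply: quotmod_splits].
Qed.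

Lemma idem_splits (e : endo M) : e * e = e -> exists D : submodClosed M,
  [/\ direct_summand D, splits (submod D) e & splits (quotmod D) (1 - e)].
Proof.
move=> ee; exists (range e); split; first exact: range_summand.
  exact: submod_splits.
exact: quotmod_splits.
Qed.

(** D1 is M itself, presented as the range of 1, and D2 is its isomorphic copy
    inside M cut out by b a. *)
Lemma left_inverse_summands (a b : endo M) : a * b = 1 ->
  exists D1 D2 : submodClosed M,
    [/\ direct_summand D1, direct_summand D2 &
        isomorphic (submod D1) (submod D2)] /\
    [/\ splits (submod D1) 1, splits (quotmod D1) (1 - 1),
        splits (submod D2) (b * a) & splits (quotmod D2) (1 - b * a)].
Proof.
move=> ab.
have [D1 [D1s s1 q1]] := idem_splits (mulr1 (1 : endo M)).
have [D2 [D2s s2 q2]] := idem_splits (left_inverse_idem ab).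
exists D1, D2; split; split=> //.
by apply/(isomorphic_equiv s1 s2); exists a, b.
Qed.
End SplitIdempotents.

(** * The equivalences *)

Section IsomorphismInvariance.
Variables (R : pzRingType) (M : lmodType R).

Definition summand_invariant (P : submodClosed M -> Prop) :=
  forall D1 D2 : submodClosed M, direct_summand D1 -> direct_summand D2 ->
  isomorphic (submod D1) (submod D2) -> P D1 -> P D2.

Lemma invariant_hom_zero_quot_df :
  summand_invariant (fun D => hom_zero (submod D) (quotmod D)) ->
  dedekind_finite (endo M).
Proof.
move=> invP a b ab; apply: corner_left_inverse => //.
have [D1 [D2 [[D1s D2s D12] [s1 q1 s2 q2]]]] := left_inverse_summands ab.
apply/(hom_zero_corner s2 q2)/(invP D1 D2) => //.
by apply/(hom_zero_corner s1 q1) => g; rewrite subrr !mul0r.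
Qed.

Lemma invariant_hom_quot_zero_df :
  summand_invariant (fun D => hom_zero (quotmod D) (submod D)) ->
  dedekind_finite (endo M).
Proof.
move=> invP a b ab; apply: corner_left_inverse_op => //.
have [D1 [D2 [[D1s D2s D12] [s1 q1 s2 q2]]]] := left_inverse_summands ab.
apply/(hom_zero_corner q2 s2)/(invP D1 D2) => //.
by apply/(hom_zero_corner q1 s1) => g; rewrite subrr !mulr0.
Qed.
End IsomorphismInvariance.

Theorem corollary7 (R : pzRingType) (M : rmodType R)
    (M_neq0 : exists x : M, x != 0) :
  [<->
    (* (a) *)
    forall D1 D2 : submodClosed M,
      direct_summand D1 -> direct_summand D2 ->
      isomorphic (submod D1) (submod D2) ->
      hom_zero (submod D1) (quotmod D1) -> hom_zero (submod D2) (quotmod D2);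
    (* (a') *)
    forall D1 D2 : submodClosed M,
      direct_summand D1 -> direct_summand D2 ->
      isomorphic (submod D1) (submod D2) ->
      hom_zero (quotmod D1) (submod D1) -> hom_zero (quotmod D2) (submod D2);
    (* (b) *)
    forall D1 D2 : submodClosed M,
      direct_summand D1 -> direct_summand D2 ->
      isomorphic (submod D1) (submod D2) ->
      hom_zero (submod D1) (quotmod D1) \/ hom_zero (quotmod D1) (submod D1) ->
      isomorphic (quotmod D1) (quotmod D2);
    (* (c) *)
    dedekind_finite (endo M)].
Proof.
tfae=> [/invariant_hom_zero_quot_df df|/invariant_hom_quot_zero_df df|Hb|df].
- move=> D1 D2 /summand_splits[e s1 q1] /summand_splits[f s2 q2].
  move=> /(isomorphic_equiv s1 s2) ef /(hom_zero_corner q1 s1) e0.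
  apply/(hom_zero_corner q2 s2).
  by have [] := equiv_complement_op df (splits_idem s1) (splits_idem s2) ef e0.
- move=> D1 D2 /summand_splits[e s1 q1] /summand_splits[f s2 q2].
  move=> /(isomorphic_equiv s1 s2) ef e0; apply/(isomorphic_equiv q1 q2).
  have [ee ff] := (splits_idem s1, splits_idem s2).
  case: e0 => [/(hom_zero_corner s1 q1)|/(hom_zero_corner q1 s1)] e0.
    by have [] := equiv_complement df ee ff ef e0.
  by have [] := equiv_complement_op df ee ff ef e0.
- move=> a b ab.
  have [D1 [D2 [[D1s D2s D12] [s1 q1 s2 q2]]]] := left_inverse_summands ab.
  have : isomorphic (quotmod D1) (quotmod D2).
    apply: Hb => //; left; apply/(hom_zero_corner s1 q1) => g.
    by rewrite subrr !mul0r.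
  move=> /(isomorphic_equiv q1 q2); rewrite subrr => /equiv0_eq0.
  by move=> /(_ (splits_idem q2))/eqP; rewrite subr_eq0 => /eqP.
- move=> D1 D2 /summand_splits[e s1 q1] /summand_splits[f s2 q2].
  move=> /(isomorphic_equiv s1 s2) ef /(hom_zero_corner s1 q1) e0.
  apply/(hom_zero_corner s2 q2).
  by have [] := equiv_complement df (splits_idem s1) (splits_idem s2) ef e0.
Qed.
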